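(* Let $n\geq 1$ be an integer. A sequence $S_1,\ldots,S_{n-1}$ of subsets of $V=\{1,2,\ldots,n\}$ is the encoding of some directed acyclic graph on the labeled vertex set $V$ if and only if $$\Bigl|\bigcup_{i=1}^{k}S_i\Bigr|\leq k\quad\text{for every } 1\leq k\leq n-1.$$
   Context: A directed graph $G=(V,E)$ consists of a finite vertex set $V$ and an edge set $E\subseteq V\times V$. A directed acyclic graph (DAG) is a directed graph containing no directed cycles (in particular no loops). A vertex $v$ is an out-neighbor of $u$ if $(u,v)\in E$. A source is a vertex with no incoming edges. DAGs on $n$ labeled vertices are taken with vertex set $V=\{1,2,\ldots,n\}$, each vertex being its own label. Let $G=(V,E)$ be a DAG with $V=\{1,2,\ldots,n\}$. The minimal source sequence $u_1,u_2,\ldots,u_n$ of $G$ is defined recursively: $u_1$ is the source of $G$ with the smallest label; for $2\leq i\leq n$, $u_i$ is the source with the smallest label in the graph obtained from $G$ by deleting the vertices $u_1,\ldots,u_{i-1}$. For $1\leq i\leq n$, let $S_{n-i}$ be the set of out-neighbors of $u_i$ in $G$ (so $S_0=\emptyset$ always). The sequence $S_1,S_2,\ldots,S_{n-1}$ is called the encoding of $G$. *)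

(* Defs.v *)
From mathcomp Require Import all_boot.

Set Implicit Arguments.
Unset Strict Implicit.
Unset Printing Implicit Defensive.

(* The vertex set {1, ..., n} is rendered as 'I_n, the vertex v : 'I_n having
   label v.+1; the order on labels is the order on the underlying naturals.
   A directed graph on 'I_n is given by its edge set E : {set 'I_n * 'I_n}.
   Sequences are tuples, whose indices start at 0: tnth u i is u_{i+1}. *)

Definition edge_rel n (E : {set 'I_n * 'I_n}) : rel 'I_n :=
  [rel x y | (x, y) \in E].

(* The cycle [:: x] is a loop at x. *)
Definition acyclic n (E : {set 'I_n * 'I_n}) : Prop :=
  forall c : seq 'I_n, c != [::] -> ~ ucycle (edge_rel E) c.

Definition out_neighbors n (E : {set 'I_n * 'I_n}) (u : 'I_n) : {set 'I_n} :=
  [set v | (u, v) \in E].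

(* v is a source of the subgraph induced on W, i.e. of the graph obtained by
   deleting the vertices outside W. *)
Definition source n (E : {set 'I_n * 'I_n}) (W : {set 'I_n}) (v : 'I_n) : bool :=
  (v \in W) && [forall u in W, (u, v) \notin E].

Definition min_source n (E : {set 'I_n * 'I_n}) (W : {set 'I_n}) (v : 'I_n)
    : Prop :=
  source E W v /\ forall w : 'I_n, source E W w -> v <= w.

Definition min_source_seq n (E : {set 'I_n * 'I_n}) (u : n.-tuple 'I_n) : Prop :=
  forall i : 'I_n,
    min_source E (~: [set tnth u j | j : 'I_n & j < i]) (tnth u i).

(* tnth S j is S_{j+1} and tnth u i is u_{i+1}, so the equation i.+1 + j.+1 = n
   pairs u_i with S_{n-i}. The set S_0 is not part of the encoding. *)
Definition is_encoding n (E : {set 'I_n * 'I_n}) (S : n.-1.-tuple {set 'I_n})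
    : Prop :=
  exists2 u : n.-tuple 'I_n, min_source_seq E u &
    forall (i : 'I_n) (j : 'I_n.-1),
      i.+1 + j.+1 = n -> tnth S j = out_neighbors E (tnth u i).

(* Main.v *)
Require Import Defs.
From mathcomp Require Import all_boot.
From mathcomp Require Import zify.

(** The minimal source sequence [u] is a topological order, so the out-neighbors
of the last [k+1] vertices of [u] lie among the last [k] ones: this is the bound.
Conversely, write [R i] for the union of the sets prescribed as out-neighborhoods
of [u_i, u_(i+1), ...]. The bound says that [R i] has fewer elements than there
are vertices left at step [i], so [u_i] can be chosen as the least remaining
vertex outside [R i]. When each [u_i] is then given its prescribed
out-neighborhood, the sources of the graph left at step [i] are exactly the
remaining vertices outside [R i]. *)

Lemma increasing_acyclic {n} (E : {set 'I_n * 'I_n}) (f : 'I_n -> nat) :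
  (forall x y, (x, y) \in E -> f x < f y) -> acyclic E.
Proof.
move=> fE [//|x p] _ /andP[/= cyc _].
have ltf_trans : transitive (relpre f ltn) by move=> y z t /=; apply: ltn_trans.
have /(order_path_min ltf_trans)/allP/(_ x) : path (relpre f ltn) x (rcons p x).
  by apply: sub_path cyc => y z; apply: fE.
by rewrite mem_rcons mem_head /= ltnn => /(_ isT).
Qed.

(** Serves both for a minimal source sequence and for the greedy sequence of the converse. *)
Lemma fresh_inj {n} {T : finType} (f : 'I_n -> T) :
  (forall i : 'I_n, f i \in ~: [set f j | j : 'I_n & j < i]) -> injective f.
Proof.
move=> fresh; have neq (i j : 'I_n) : j < i -> f j != f i.
  move=> lt_ji; have := fresh i; rewrite inE; apply: contraNneq => <-.
  by apply: imset_f; rewrite inE.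
by move=> i j eq_ij; apply/val_inj; case: (ltngtP i j) => // /neq /eqP[].
Qed.

Section MinSourceSeq.

Context {n : nat} {E : {set 'I_n * 'I_n}} {u : n.-tuple 'I_n}.
Hypothesis uE : min_source_seq E u.

Lemma min_source_seq_inj : injective (tnth u).
Proof.
by apply: fresh_inj => i; have [/andP[]] := uE i.
Qed.

(** If [j <= i], then [tnth u i] is not yet deleted at step [j], so an edge from it would keep
    [tnth u j] from being a source. *)
Lemma min_source_seq_topological (i j : 'I_n) :
  (tnth u i, tnth u j) \in E -> i < j.
Proof.
move=> Eij; rewrite ltnNge; apply/negP => le_ji.
have [/andP[_ /forall_inP/(_ (tnth u i))]] := uE j; rewrite Eij => Hj _.
suff /Hj : tnth u i \in ~: [set tnth u k | k : 'I_n & k < j] by [].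
rewrite inE; apply/imsetP => -[k]; rewrite inE => lt_kj /min_source_seq_inj eq_ik.
by move: lt_kj; rewrite -eq_ik ltnNge le_ji.
Qed.

End MinSourceSeq.

(** Only an inequality, since [k] may exceed [n]. *)
Lemma card_ord_ge n k : #|[set j : 'I_n | n - k <= j]| <= k.
Proof.
have -> : [set j : 'I_n | n - k <= j] = [set rev_ord j | j : 'I_n & j < k].
  apply/setP => j; rewrite inE; apply/idP/imsetP => [le_j|[i]].
    exists (rev_ord j); rewrite ?rev_ordK // inE /=.
    by have := ltn_ord j; lia.
  by rewrite inE => lt_ik -> /=; have := ltn_ord i; lia.
rewrite (leq_trans (leq_imset_card _ _)) // cardE -(size_map val).
rewrite -[leqRHS](size_iota 0); apply: uniq_leq_size.
  by rewrite (map_inj_uniq val_inj) enum_uniq.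
by move=> x /mapP[j]; rewrite mem_enum inE => lt_jk ->; rewrite mem_iota.
Qed.

Lemma encoding_card_bigcup n (E : {set 'I_n * 'I_n}) (S : n.-1.-tuple {set 'I_n})
    (k : nat) :
  is_encoding E S -> #|\bigcup_(i < n.-1 | i < k) tnth S i| <= k.
Proof.
case=> u uE SE; apply: leq_trans (card_ord_ge n k).
apply: leq_trans (leq_imset_card (tnth u) _); apply: subset_leq_card.
apply/bigcupsP => j lt_jk; apply/subsetP => v.
(* With indices from 0, [tnth S j] is the out-neighborhood of the vertex at position [n - j.+2]. *)
have lt_j := ltn_ord j; have lt_i : n - j.+2 < n by lia.
rewrite (SE (Ordinal lt_i)) /=; last by lia.
rewrite inE; have [g gK Kg] := injF_bij (min_source_seq_inj uE).
rewrite -[v]Kg => /(min_source_seq_topological uE) /= lt_ig.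
by apply: imset_f; rewrite inE; lia.
Qed.

Lemma exists_greedy_seq {n} {R : nat -> {set 'I_n}} {m : nat} :
  (forall i, i < m -> #|R i| < n - i) ->
  exists2 u : seq 'I_n, size u = m & forall x0 i, i < m ->
    [/\ nth x0 u i \notin take i u, nth x0 u i \notin R i &
        forall w, w \notin take i u -> w \notin R i -> nth x0 u i <= w].
Proof.
elim: m => [|m IHm] ltR; first by exists [::].
have [|u szu Pu] := IHm; first by move=> i lt_im; apply: ltR; apply: ltnW.
(* The [m] vertices chosen so far and the fewer than [n - m] elements of [R m] cannot exhaust
   ['I_n]. *)
have [x Px] : exists x, (x \notin u) && (x \notin R m).
  have : [set x in u] :|: R m != setT.
    have le_u : #|[set x in u]| <= m by rewrite cardsE -szu card_size.
    apply/negP => /eqP/(congr1 (fun A : {set 'I_n} => #|A|)).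
    rewrite cardsT card_ord => eq_n.
    have := leq_trans (leq_card_setU [set x in u] (R m)).1 (leq_add le_u (leqnn _)).
    by rewrite eq_n -leq_subLR leqNgt ltR.
  by rewrite -subTset => /subsetPn[x _]; rewrite !inE negb_or; exists x.
case: (arg_minnP (P := [pred y | (y \notin u) && (y \notin R m)]) val Px).
move=> y /= /andP[yu yR] ymin.
exists (rcons u y) => [|x0 i]; first by rewrite size_rcons szu.
rewrite ltnS leq_eqVlt => /orP[/eqP-> | lt_im].
  rewrite nth_rcons szu ltnn eqxx -szu -cats1 take_size_cat // szu.
  by split=> // w wu wR; apply: ymin; rewrite wu.
by rewrite nth_rcons szu lt_im -cats1 take_cat szu lt_im; apply: Pu.
Qed.

Lemma take_tupleE {n} {T : finType} (u : n.-tuple T) (i : nat) :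
  [set x in take i u] = [set tnth u j | j : 'I_n & j < i].
Proof.
apply/setP => x; rewrite inE; apply/idP/imsetP => [x_u|[j]].
  have x_u' : x \in u by apply: mem_take x_u.
  have lt_x : index x u < n by rewrite -[ltnRHS](size_tuple u) index_mem.
  exists (Ordinal lt_x); last by rewrite (tnth_nth x) nth_index.
  by rewrite inE /= -in_take.
rewrite inE => lt_ji ->; rewrite (tnth_nth (tnth u j)) -(nth_take _ lt_ji).
by apply: mem_nth; rewrite size_take size_tuple; case: ifP.
Qed.

Theorem theorem2p1 (n : nat) (hn : 1 <= n) (S : n.-1.-tuple {set 'I_n}) :
  (exists E : {set 'I_n * 'I_n}, acyclic E /\ is_encoding E S) <->
  (forall k : nat, 1 <= k <= n.-1 ->
     #|\bigcup_(i < n.-1 | i < k) tnth S i| <= k).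
Proof.
split=> [[E [_ SE]] k _|cardS]; first exact: encoding_card_bigcup SE.
pose R i := \bigcup_(j < n.-1 | j < n.-1 - i) tnth S j.
have ltR i : i < n -> #|R i| < n - i.
  (* At the last position the union is empty; [cardS] says nothing about [k = 0]. *)
  move=> lt_in; have [eq_i|i_gt0] := posnP (n.-1 - i).
    by rewrite /R eq_i big_pred0 ?cards0 ?subn_gt0.
  by have := cardS (n.-1 - i); rewrite -/(R i); lia.
have [s szs Ps] := exists_greedy_seq ltR.
have {szs} szs : size s == n by apply/eqP.
pose u := Tuple szs.
pose W i := ~: [set tnth u j | j : 'I_n & j < i].
have uP (i : 'I_n) : [/\ tnth u i \in W i, tnth u i \notin R i &
    forall w, w \in W i -> w \notin R i -> tnth u i <= w].
  have := Ps (tnth u i) i (ltn_ord i).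
  rewrite -(tnth_nth _ u) => -[uW uR umin]; rewrite /W -take_tupleE.
  split=> [||w]; rewrite ?inE //; exact: umin.
have u_inj : injective (tnth u).
  by apply: fresh_inj => i; have [] := uP i.
have [g gK Kg] := injF_bij u_inj.
(* [g] gives the position of a vertex in [u]. The last vertex matches no [j] and so has no
   out-neighbor. *)
pose E := [set p : 'I_n * 'I_n |
  [exists j : 'I_n.-1, ((g p.1).+1 + j.+1 == n) && (p.2 \in tnth S j)]].
have EP (i : 'I_n) v : reflect (exists2 j : 'I_n.-1, i.+1 + j.+1 = n & v \in tnth S j)
    ((tnth u i, v) \in E).
  rewrite inE /= gK.
  by apply: (iffP existsP) => -[j]; [case/andP=> /eqP | move=> /eqP]; exists j => //; apply/andP.
(* [R i] collects the out-neighbors of the vertices at positions at least [i], and these vertices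
   form [W i]. *)
have sourceE (i : 'I_n) v : source E (W i) v = (v \in W i) && (v \notin R i).
  congr (_ && _); apply/forall_inP/negP => [vW /bigcupP[j lt_j v_j]|vR x xW].
    have lt_i : n - j.+2 < n by lia.
    suff /vW/negP : tnth u (Ordinal lt_i) \in W i.
      by apply; apply/EP; exists j => //=; have := ltn_ord j; lia.
    rewrite inE; apply/imsetP => -[k]; rewrite inE => lt_ki /u_inj eq_k.
    by move: lt_ki; rewrite -eq_k /=; lia.
  rewrite -[x]Kg; apply/EP => -[j eq_n v_j]; apply: vR; apply/bigcupP; exists j => //.
  suff : i <= g x by lia.
  rewrite leqNgt; apply/negP => lt_gi; move: xW; rewrite inE => /negP; apply.
  by rewrite -[x]Kg; apply: imset_f; rewrite inE.
have uE : min_source_seq E u.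
  move=> i; have [uW uR umin] := uP i; split; first by rewrite sourceE uW.
  by move=> w; rewrite sourceE => /andP[]; apply: umin.
exists E; split.
  (* Positions increase along edges because [u] is now known to be the minimal source sequence of
     [E]. *)
  apply: (@increasing_acyclic _ _ g) => x y.
  by rewrite -{1}[x]Kg -{1}[y]Kg; apply: (min_source_seq_topological uE).
exists u => // i j eq_n; apply/setP => v; rewrite inE; apply/idP/EP => [v_j|[k eq_k]].
  by exists j.
by have -> : k = j by apply/val_inj => /=; lia.
Qed.
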